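(* Let $\mathbb{S}_*^2$ be the multiplicative sphere of radius $1_*$ centered at $\mathbf{0}_*$. Let $\mathbf{x}(s)\subset\mathbb{E}_*^3$ be a multiplicative rectifying curve with $\kappa\neq0_*$, parametrized by multiplicative arc length. Then there is a multiplicative reparametrization of $\mathbf{x}(s)$, with new parameter $\tilde s$, such that $$\mathbf{x}(\tilde s)=(a\cdot_*\sec_*\tilde s)\cdot_*\mathbf{y}(\tilde s)$$ for some $a\in\mathbb{R}_*$, $a>0_*$, where $\mathbf{y}(\tilde s)$ is a curve lying in $\mathbb{S}_*^2$ and parametrized by multiplicative arc length. Conversely, if a multiplicative curve with $\kappa\neq0_*$ in $\mathbb{E}_*^3$ has a parametrization of the form $\mathbf{x}(\tilde s)=(a\cdot_*\sec_*\tilde s)\cdot_*\mathbf{y}(\tilde s)$ with $a\in\mathbb{R}_*$, $a>0_*$, and $\mathbf{y}(\tilde s)$ a curve lying in $\mathbb{S}_*^2$ parametrized by multiplicative arc length, then it is a multiplicative rectifying curve.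
   Context: Multiplicative arithmetic. $\mathbb{R}_*$ is the set of positive reals with the field operations $a+_*b=e^{\log a+\log b}$, $a-_*b=e^{\log a-\log b}$, $a\cdot_*b=e^{\log a\log b}$, $a/_*b=e^{\log a/\log b}$ ($b\ne1$); $0_*=1$, $1_*=e$; $>$ is the usual order. Also $a^{2_*}=e^{(\log a)^2}$ and $a^{\frac12_*}=e^{\sqrt{\log a}}$ (for $a\ge 1$). The multiplicative secant is $\sec_*s=e^{\sec(\log s)}$, for $s\in\mathbb{R}_*$ with $\cos(\log s)\ne0$. Multiplicative derivative. For $f:I\to\mathbb{R}_*$, $I\subset\mathbb{R}_*$ an interval, $f^*(s)=\lim_{h\to1}(f(s+_*h)-_*f(s))/_*h=e^{s(\log f(s))'}$, with $'$ the usual derivative. All functions are multiplicative differentiable to whatever order is needed. For vector-valued functions the derivative is taken componentwise. Multiplicative Euclidean space. $\mathbb{E}_*^3$ is $\mathbb{R}_*^3$ with $\mathbf{x}+_*\mathbf{y}=(x_iy_i)_i$, $a\cdot_*\mathbf{x}=(e^{\log a\log x_i})_i$, zero vector $\mathbf{0}_*=(1,1,1)$, inner product $\langle\mathbf{x},\mathbf{y}\rangle_*=e^{\sum_i\log x_i\log y_i}$, norm $\|\mathbf{x}\|_*=\langle\mathbf{x},\mathbf{x}\rangle_*^{\frac12_*}=e^{\sqrt{\sum_i(\log x_i)^2}}$. Cross product: $\mathbf{x}\times_*\mathbf{y}=(e^{\log x_2\log y_3-\log x_3\log y_2},e^{\log x_3\log y_1-\log x_1\log y_3},e^{\log x_1\log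 y_2-\log x_2\log y_1})$. Vectors are multiplicative collinear iff their cross product is $\mathbf{0}_*$. Subtraction of vectors and scalar division $\mathbf{x}/_*a$ are componentwise. The multiplicative sphere of radius $r>0_*$ centered at $\mathbf{0}_*$ is $\{Q\in\mathbb{E}_*^3:\|Q\|_*=r\}$. Curves. $\mathbf{x}:I\to\mathbb{E}_*^3$ is multiplicative regular if $\mathbf{x}^*$ is nowhere $\mathbf{0}_*$, and is parametrized by multiplicative arc length if $\|\mathbf{x}^*(s)\|_*=1_*$ for all $s$; every regular curve has a multiplicative arc length parametrization. A multiplicative reparametrization is a bijective change of parameter $s=s(\tilde s)$ between intervals that is multiplicative differentiable with multiplicative derivative nowhere $0_*$. An arc length parametrized curve is multiplicative biregular if $\mathbf{x}^*(s)$ and $\mathbf{x}^{**}(s)$ are nowhere multiplicative collinear. Its multiplicative Frenet frame is $\mathbf{t}=\mathbf{x}^*$, $\mathbf{n}=\mathbf{x}^{**}/_*\|\mathbf{x}^{**}\|_*$, $\mathbf{b}=\mathbf{t}\times_*\mathbf{n}$, and its multiplicative curvature is $\kappa=\|\mathbf{x}^{**}\|_*$; $\kappa\ne0_*$ means nowhere equal to $0_*$. For a curve given in another regular parametrization, these notions refer to its multiplicative arc length parametrization. A multiplicative biregular curve $\mathbf{x}$ is a multiplicative rectifying curve if $\langle\mathbf{x},\mathbf{n}\rangle_*=0_*$ at every parameter value. *)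

(* Defs.v *)
From HB Require Import structures.
From mathcomp Require Import all_boot all_order all_algebra.
From mathcomp Require Import all_classical all_reals all_analysis.
Import Order.TTheory GRing.Theory Num.Theory.
Import numFieldNormedType.Exports.
Set Implicit Arguments.
Unset Strict Implicit.
Unset Printing Implicit Defensive.
Local Open Scope classical_set_scope.
Local Open Scope ring_scope.

(* The multiplicative reals: the positive reals, with the topology induced by
   R.  As a pointed type, the base point is the multiplicative zero. *)
Definition mreal (R : realType) : Type := {posnum R}.

Section Mreal.
Variable R : realType.
HB.instance Definition _ := Choice.copy (mreal R) {posnum R}.
HB.instance Definition _ := isPointed.Build (mreal R) (1%:pos : {posnum R}).
HB.instance Definition _ := Topological.copy (mreal R)
  (initial_topology (fun a : {posnum R} => a%:num : R)).
End Mreal.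

Definition mval (R : realType) (a : mreal R) : R := (a : {posnum R})%:num.

(* mlog and mexp are mutually inverse bijections between mreal R and R *)
Definition mlog (R : realType) (a : mreal R) : R := ln (mval a).
Definition mexp (R : realType) (u : R) : mreal R := PosNum (expR_gt0 u).

Section MultiplicativeArithmetic.
Variable R : realType.
Implicit Types a b : mreal R.

Definition mreal0 : mreal R := mexp 0.
Definition mreal1 : mreal R := mexp 1.
Definition madd a b : mreal R := mexp (mlog a + mlog b).
Definition msub a b : mreal R := mexp (mlog a - mlog b).
Definition mmul a b : mreal R := mexp (mlog a * mlog b).
(* meaningful for b <> mreal0 only *)
Definition mdiv a b : mreal R := mexp (mlog a / mlog b).
(* meaningful for 1 <= a only *)
Definition msqrt a : mreal R := mexp (Num.sqrt (mlog a)).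
Definition mlt a b : Prop := mval a < mval b.
(* meaningful for cos (mlog s) <> 0 only *)
Definition msec (s : mreal R) : mreal R := mexp (cos (mlog s))^-1.

Definition minterval (I : set (mreal R)) : Prop :=
  is_interval [set mval s | s in I] /\
  exists s1 s2, [/\ I s1, I s2 & s1 <> s2].

End MultiplicativeArithmetic.

Arguments mreal0 {R}.
Arguments mreal1 {R}.

Declare Scope mreal_scope.
Notation "a +_* b" := (madd a b) (at level 50, left associativity) : mreal_scope.
Notation "a -_* b" := (msub a b) (at level 50, left associativity) : mreal_scope.
Notation "a *_* b" := (mmul a b) (at level 40, left associativity) : mreal_scope.
Notation "a /_* b" := (mdiv a b) (at level 40, left associativity) : mreal_scope.
Local Open Scope mreal_scope.

Section MultiplicativeDerivative.
Variable R : realType.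
Implicit Types (I : set (mreal R)) (f : mreal R -> mreal R).

(* The difference quotient is taken along the h for which s +_* h stays in I,
   so the derivative is one-sided at an endpoint of I belonging to I, and it
   does not depend on the values of f outside I. *)
Definition mquotients I f (s : mreal R) : set_system (mreal R) :=
  (f (s +_* h) -_* f s) /_* h
    @[h --> within [set h | h <> mreal0 /\ I (s +_* h)] (nbhs (mreal0 : mreal R))].

Definition mderivable I f (s : mreal R) : Prop := cvg (mquotients I f s).

Definition mderive I f (s : mreal R) : mreal R := lim (mquotients I f s).

Definition msmooth I f : Prop :=
  forall (n : nat) s, I s -> mderivable I (iter n (mderive I) f) s.

(* s = phi(t), from the new parameter t in J to the old parameter s in I *)
Definition mreparametrization (J I : set (mreal R)) (phi : mreal R -> mreal R)
    : Prop :=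
  [/\ minterval J, minterval I, set_bij J I phi, msmooth J phi &
      forall t, J t -> mderive J phi t <> mreal0].

End MultiplicativeDerivative.

(* Multiplicative Euclidean 3-space: triples of multiplicative reals *)
Definition mspace (R : realType) : Type := 'rV[mreal R]_3.

Section MultiplicativeSpace.
Variable R : realType.
Implicit Types (x y : mspace R) (a r : mreal R).

Definition mcoord x (i : 'I_3) : mreal R := x ord0 i.
Definition mspace0 : mspace R := \row_i mreal0.
Definition mvscale a x : mspace R := \row_i (a *_* mcoord x i).
Definition mvdiv x a : mspace R := \row_i (mcoord x i /_* a).
Definition minner x y : mreal R :=
  mexp (\sum_i mlog (mcoord x i) * mlog (mcoord y i)).
Definition mnorm x : mreal R := msqrt (minner x x).

(* Indices are taken modulo 3: the i-th coordinate is built from the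
   coordinates i + 1 and i + 2, as in the usual cyclic formula. *)
Definition mcross x y : mspace R :=
  \row_(i < 3) mexp (mlog (mcoord x (i + 1)) * mlog (mcoord y (i + 2%:R))
                   - mlog (mcoord x (i + 2%:R)) * mlog (mcoord y (i + 1))).

Definition mcollinear x y : Prop := mcross x y = mspace0.

Definition msphere r : set (mspace R) := [set x | mnorm x = r].

End MultiplicativeSpace.

Arguments mspace0 {R}.

Section Curves.
Variable R : realType.
Implicit Types (I J K : set (mreal R)) (x y u : mreal R -> mspace R).

Definition mvderive I x (s : mreal R) : mspace R :=
  \row_i mderive I (fun v => mcoord (x v) i) s.

Definition mcurve I x : Prop :=
  minterval I /\ forall i, msmooth I (fun v => mcoord (x v) i).

Definition mregular I x : Prop :=
  mcurve I x /\ forall s, I s -> mvderive I x s <> mspace0.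

Definition marc_length I x : Prop :=
  mcurve I x /\ forall s, I s -> mnorm (mvderive I x s) = mreal1.

(* The next five notions are those of a curve parametrized by arc length. *)
Definition mbiregular I x : Prop :=
  forall s, I s -> ~ mcollinear (mvderive I x s) (mvderive I (mvderive I x) s).

Definition mcurvature I x (s : mreal R) : mreal R :=
  mnorm (mvderive I (mvderive I x) s).

Definition mnormal I x (s : mreal R) : mspace R :=
  mvdiv (mvderive I (mvderive I x) s) (mcurvature I x s).

Definition mcurvature_neq0 I x : Prop :=
  forall s, I s -> mcurvature I x s <> mreal0.

Definition mrectifying I x : Prop :=
  [/\ marc_length I x, mbiregular I x &
      forall s, I s -> minner (x s) (mnormal I x s) = mreal0].

(* u on K is an arc length parametrization of the curve x on I *)
Definition marc_length_param I x K u : Prop :=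
  marc_length K u /\
  exists2 psi, mreparametrization K I psi & forall k, K k -> u k = x (psi k).

(* A notion P defined for arc length parametrized curves, carried over to an
   arbitrary regular parametrization.  Arc length parametrizations of a curve
   are unique up to translation and reversal of the parameter only, so P is
   asked of each of them (and there is one). *)
Definition on_arc_length (P : set (mreal R) -> (mreal R -> mspace R) -> Prop)
    I x : Prop :=
  (exists K u, marc_length_param I x K u) /\
  (forall K u, marc_length_param I x K u -> P K u).

(* x on I is reparametrized by s = phi(t), t in J, into the form
   t |-> (a . sec t) . y(t), with y an arc length parametrized curve on the
   unit sphere; sec t has to be defined on all of J *)
Definition msecant_form I x : Prop :=
  exists (J : set (mreal R)) (phi : mreal R -> mreal R) (a : mreal R)
         (y : mreal R -> mspace R),
  [/\ mreparametrization J I phi /\ mlt mreal0 a,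
      forall t, J t -> cos (mlog t) <> 0,
      marc_length J y,
      forall t, J t -> msphere mreal1 (y t) &
      forall t, J t -> x (phi t) = mvscale (a *_* msec t) (y t)].

End Curves.

(* Main.v *)
(* Taking logarithms turns multiplicative curves into ordinary curves
   [X : A -> R^3] on an interval, with derivatives taken within [A].

   If [X] has unit speed and [X . X'' = 0], then [g := X . X'] has derivative
   [1 + X . X'' = 1], so [g = u + c], and [|X|^2 - g^2] is constant.  It equals
   [|X - g X'|^2], and cannot vanish: otherwise [X = g X'], whence [g X'' = 0].
   With [|X|^2 = (u + c)^2 + a^2], the substitution [u + c = a tan t] gives
   [|X| = a sec t], and [X / |X|] has unit speed in [t].

   Conversely, if [X = a sec theta . Y] up to reparametrization, with [Y] on the
   sphere, the chain rule gives [g^2 = a^2 tan^2 theta] and [|X|^2 = a^2 + g^2].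
   Differentiating, [g = g g'], hence [g' = 1], that is [X . X'' = 0], wherever [g]
   does not vanish on a neighbourhood; and [g] vanishes at most once since [theta]
   is injective with values in an interval on which [cos] has no zero. *)
Require Import Defs.
From mathcomp Require Import all_boot all_order all_algebra.
From mathcomp Require Import all_classical all_reals all_analysis.
From mathcomp Require Import ring lra.
Import Order.TTheory GRing.Theory Num.Theory.
Import numFieldNormedType.Exports.
Set Implicit Arguments.
Unset Strict Implicit.
Unset Printing Implicit Defensive.
Local Open Scope classical_set_scope.
Local Open Scope ring_scope.
Local Open Scope mreal_scope.

(** * Derivatives, mean value theorem and smoothness within a subset of the real line *)

Section WithinDerivative.
Variable R : realType.
Implicit Types (A B : set R) (f g : R -> R) (s l m : R).

Definition nondeg_interval A : Prop :=
  is_interval A /\ exists s1 s2, [/\ A s1, A s2 & s1 <> s2].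

(** A relation rather than a function, so that existence and value of the derivative travel
    together. Limits are taken along [A], hence one-sided at an endpoint, which matches [mquotients]
    in logarithmic coordinates. *)
Definition wderiv A f s l : Prop :=
  (f u - f s) / (u - s) @[u --> within A s^'] --> l.

Lemma near_within_dnbhs A s (P : set R) :
  (forall u, A u -> u != s -> P u) -> \forall u \near within A s^', P u.
Proof.
move=> AP; rewrite /dnbhs !near_withinE; apply: nearW => u us Au.
exact: AP.
Qed.

(** For another point [p] of [A], the points [s + d * (p - s)] with [0 < d <= 1] stay in [A] by
    convexity and approach [s] as [d] shrinks. Properness of this filter is what makes derivatives
    within [A] unique. *)
Lemma nondeg_interval_proper A s :
  nondeg_interval A -> A s -> ProperFilter (within A s^').
Proof.
move=> [itvA [s1 [s2 [As1 As2 s12]]]] As.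
apply: Build_ProperFilter_ex => P.
have [p Ap /eqP ps] : exists2 p, A p & p <> s.
  have [s1s|] := eqVneq s1 s; last by move=> /eqP s1s; exists s1.
  by exists s2 => // s2s; apply: s12; rewrite s1s.
rewrite /dnbhs /within/= => -[e /= e0 eP].
have [d [d0 d1 de]] : exists d : R, [/\ 0 < d, d <= 1 & d * `|p - s| < e].
  have ps0 : 0 < `|p - s| by rewrite normr_gt0 subr_eq0.
  exists (Num.min 1 (e / 2 / `|p - s|)); split.
  - by rewrite lt_min ltr01 !divr_gt0.
  - by rewrite ge_min lexx.
  - rewrite -ltr_pdivlMr// gt_min; apply/orP; right.
    by rewrite ltr_pM2r ?invr_gt0// gtr_pMr// invf_lt1 ?ltr1n.
exists (s + d * (p - s)); apply: eP => /=.
- by rewrite opprD addNKr normrN normrM gtr0_norm.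
- by rewrite -subr_eq0 addrAC subrr add0r mulf_neq0 ?subr_eq0// gt_eqF.
- have [sp|sp] := leP s p.
    by apply: (itvA s p) => //; nra.
  by apply: (itvA p s) => //; nra.
Qed.

Lemma wderiv_eq A f g s l : (forall u, A u -> f u = g u) -> A s ->
  wderiv A f s l -> wderiv A g s l.
Proof.
move=> fg As; apply: cvg_trans; apply: near_eq_cvg.
by apply: near_within_dnbhs => u Au _; rewrite !fg.
Qed.

Lemma wderiv_unique A f s l m : nondeg_interval A -> A s ->
  wderiv A f s l -> wderiv A f s m -> l = m.
Proof.
move=> An As fl fm; have FF := nondeg_interval_proper An As.
exact: cvg_unique fl fm.
Qed.

Lemma wderiv_cst A c s : wderiv A (fun=> c) s 0.
Proof.
apply: cvg_near_cst; apply: near_within_dnbhs => u _ _.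
by rewrite subrr mul0r.
Qed.

Lemma wderiv_id A s : wderiv A id s 1.
Proof.
apply: cvg_near_cst; apply: near_within_dnbhs => u _ us.
by rewrite mulfV// subr_eq0.
Qed.

Lemma cvg_within_dnbhs A s : u @[u --> within A s^'] --> s.
Proof.
by move=> P sP; rewrite /= /within/=; apply: filterS (nbhs_dnbhs sP) => u Pu _.
Qed.

Lemma wderiv_cvg A f s l : wderiv A f s l -> f u @[u --> within A s^'] --> f s.
Proof.
move=> fl.
have h : (f u - f s) / (u - s) * (u - s) + f s @[u --> within A s^'] -->
    l * (s - s) + f s.
  apply: cvgD; last exact: cvg_cst.
  apply: cvgM => //.
  by apply: cvgB; [exact: cvg_within_dnbhs|exact: cvg_cst].
rewrite subrr mulr0 add0r in h; apply: cvg_trans h; apply: near_eq_cvg.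
by apply: near_within_dnbhs => u _ us; rewrite divfK ?subrK// subr_eq0.
Qed.

Lemma wderivD A f g s l m : wderiv A f s l -> wderiv A g s m ->
  wderiv A (fun u => f u + g u) s (l + m).
Proof.
move=> fl gm; apply: cvg_trans (cvgD fl gm); apply: near_eq_cvg.
by apply: nearW => u; rewrite !fctE -mulrDl; congr (_ / _); ring.
Qed.

Lemma wderivM A f g s l m : wderiv A f s l -> wderiv A g s m ->
  wderiv A (fun u => f u * g u) s (l * g s + f s * m).
Proof.
move=> fl gm.
have h : (f u - f s) / (u - s) * g u + f s * ((g u - g s) / (u - s))
    @[u --> within A s^'] --> l * g s + f s * m.
  by apply: cvgD; apply: cvgM => //; [exact: wderiv_cvg gm|exact: cvg_cst].
apply: cvg_trans h; apply: near_eq_cvg; apply: near_within_dnbhs => u _ us.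
by have {}us : u - s != 0; [rewrite subr_eq0|field].
Qed.

Lemma wderivZ A f s l c : wderiv A f s l -> wderiv A (fun u => c * f u) s (c * l).
Proof.
by move=> fl; have := wderivM (wderiv_cst A c s) fl; rewrite mul0r add0r.
Qed.

Lemma wderivB A f g s l m : wderiv A f s l -> wderiv A g s m ->
  wderiv A (fun u => f u - g u) s (l - m).
Proof.
move=> fl gm; have := wderivD fl (wderivZ (c := -1) gm); rewrite mulN1r.
by under eq_fun do rewrite mulN1r.
Qed.

Lemma wderiv_sum A n (f : 'I_n -> R -> R) s (l : 'I_n -> R) :
  (forall i, wderiv A (f i) s (l i)) ->
  wderiv A (fun u => \sum_i f i u) s (\sum_i l i).
Proof.
elim: n f l => [|n IHn] f l fl.
  by rewrite big_ord0; under eq_fun do rewrite big_ord0; exact: wderiv_cst.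
rewrite big_ord_recr/=; under eq_fun do rewrite big_ord_recr/=.
by apply: wderivD => //; apply: IHn.
Qed.

Lemma wderiv_comp A B f g s l m : (forall u, A u -> B (g u)) ->
  wderiv A g s l -> wderiv B f (g s) m -> wderiv A (f \o g) s (m * l).
Proof.
move=> AB gl fm.
(* [g] may take the value [g s] again arbitrarily close to [s], where the quotient of [f]
   degenerates. Filling in [m] there makes [q] converge along the unpunctured neighbourhoods, and
   the quotient of [f \o g] is [q (g u)] times that of [g] in every case. *)
pose q v := if v == g s then m else (f v - f (g s)) / (v - g s).
have qc : q v @[v --> within B (nbhs (g s))] --> m.
  move=> P mP; suff : nbhs (g s) [set v | B v -> P (q v)] by [].
  apply: filterS (fm P mP : nbhs (g s) [set v | v != g s -> B v -> P _]).
  move=> v /= qP Bv; rewrite /q; case: eqVneq => [_|vs]; last exact: qP.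
  exact: nbhs_singleton.
have gc : g u @[u --> within A s^'] --> within B (nbhs (g s)).
  move=> P BP; suff : nbhs s [set u | u != s -> A u -> P (g u)] by [].
  apply: filterS (wderiv_cvg gl BP : nbhs s [set u | u != s -> A u -> B _ -> P _]).
  by move=> u /= uP us Au; apply: uP => //; exact: AB.
have qgc : q (g u) @[u --> within A s^'] --> m by move=> P /qc /gc.
apply: cvg_trans (cvgM qgc gl); apply: near_eq_cvg.
apply: near_within_dnbhs => u _ us; rewrite !fctE /q /=.
have {}us : u - s != 0 by rewrite subr_eq0.
case: eqVneq => [->|]; first by rewrite !subrr mul0r mulr0.
by rewrite -subr_eq0 => gus; field; apply/andP.
Qed.

Lemma is_derive_wderiv A f s l : is_derive s 1 f l -> wderiv A f s l.
Proof.
move=> [df dfl].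
have h : h^-1 *: (f (h *: 1 + s) - f s) @[h --> 0^'] --> l.
  by rewrite -dfl; exact: df.
have c0 : u - s @[u --> within A s^'] --> 0^'.
  have c1 : u - s @[u --> s] --> s - s.
    by apply: cvgB; [exact: cvg_id|exact: cvg_cst].
  rewrite subrr in c1.
  move=> P P0; suff : nbhs s [set u | u != s -> A u -> P (u - s)] by [].
  apply: filterS (c1 _ P0 : nbhs s [set u | u - s != 0 -> P _]).
  by move=> u /= uP us _; apply: uP; rewrite subr_eq0.
have h0 : (u - s)^-1 *: (f ((u - s) *: 1 + s) - f s) @[u --> within A s^'] --> l.
  by move=> P /h /c0.
apply: cvg_trans h0; apply: near_eq_cvg.
apply: nearW => u /=.
by rewrite [_%:A]mulr1 subrK mulrC.
Qed.

Lemma wderiv_is_derive A f s l : nbhs s A -> wderiv A f s l -> is_derive s 1 f l.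
Proof.
move=> sA fl.
have h : h^-1 *: (f (h *: 1 + s) - f s) @[h --> 0^'] --> l.
  have c0 : h + s @[h --> 0^'] --> within A s^'.
    have c1 : h + s @[h --> (0 : R)] --> 0 + s.
      by apply: cvgD; [exact: cvg_id|exact: cvg_cst].
    rewrite add0r in c1.
    move=> P P0; suff : nbhs (0 : R) [set h | h != 0 -> P (h + s)] by [].
    have P0' : nbhs s [set u | u != s -> A u -> P u] := P0.
    have P0s : nbhs (0 : R)
        [set h | A (h + s) /\ (h + s != s -> A (h + s) -> P (h + s))].
      exact: c1 _ (filterI sA P0').
    apply: filterS P0s => u /= [Au uP] u0.
    by apply: uP => //; rewrite -subr_eq0 addrK.
  have h0 : (f (h + s) - f s) / (h + s - s) @[h --> 0^'] --> l.
    by move=> P /fl /c0.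
  apply: cvg_trans h0; apply: near_eq_cvg.
  by apply: nearW => u /=; rewrite [_%:A]mulr1 addrK mulrC.
by split; [apply/cvg_ex; exists l|exact: cvg_lim].
Qed.

(** Reduces to the classical theorem: between [a] and [b] the derivative within [A] is two-sided,
    and at the endpoints continuity along [A] suffices. *)
Lemma wderiv_MVT A f f' a b : is_interval A ->
  (forall s, A s -> wderiv A f s (f' s)) -> A a -> A b -> a < b ->
  exists2 c, A c & f b - f a = f' c * (b - a).
Proof.
move=> itvA ff' Aa Ab ab.
have Aab c : a <= c <= b -> A c by exact: itvA.
have [||c] := @MVT R f f' a b ab.
- move=> c; rewrite in_itv/= => /andP[ac cb]; apply: (@wderiv_is_derive A).
    have : \forall x \near c, x \in `]a, b[.
      by apply: near_in_itvoo; rewrite in_itv/= ac.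
    apply: filterS => x; rewrite in_itv/= => /andP[ax xb].
    by apply: Aab; rewrite !ltW.
  by apply: ff'; apply: Aab; rewrite !ltW.
- apply/subspace_continuousP => c /=; rewrite in_itv/= => acb P fcP.
  suff : nbhs c [set u | u \in `[a, b] -> P (f u)] by [].
  apply: filterS (wderiv_cvg (ff' c (Aab _ acb)) fcP
    : nbhs c [set u | u != c -> A u -> P _]).
  move=> u /= uP; rewrite in_itv/= => /Aab Au.
  have [->|uc] := eqVneq u c; first exact: nbhs_singleton.
  exact: uP.
- rewrite in_itv/= => /andP[ac cb] fab; exists c => //.
  by apply: Aab; rewrite !ltW.
Qed.

Lemma wderiv0_cst A f a b : is_interval A ->
  (forall s, A s -> wderiv A f s 0) -> A a -> A b -> f a = f b.
Proof.
move=> itvA f0; wlog ab : a b / a < b => [hw|] Aa Ab.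
  have [ab|ba|->//] := ltgtP a b; first exact: hw.
  by apply/esym/hw.
have [c _] := wderiv_MVT itvA f0 Aa Ab ab.
by rewrite mul0r => /eqP; rewrite subr_eq0 => /eqP.
Qed.

(** The successive derivatives are existential and constrained on [A] only, so any convenient closed
    form can serve as witness. *)
Fixpoint wsmooth n A f : Prop :=
  if n is n'.+1 then
    exists2 f', (forall s, A s -> wderiv A f s (f' s)) & wsmooth n' A f'
  else True.

Lemma wsmoothW n A f : wsmooth n.+1 A f -> wsmooth n A f.
Proof.
elim: n f => // n IHn f [f' ff' sf']; exists f' => //; exact: IHn.
Qed.

Lemma wsmooth_eq n A f g : (forall u, A u -> f u = g u) ->
  wsmooth n A f -> wsmooth n A g.
Proof.
case: n => // n fg [f' ff' sf']; exists f' => // s As.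
by apply: wderiv_eq (ff' s As).
Qed.

Lemma wsmooth_cst n A c : wsmooth n A (fun=> c).
Proof. by elim: n c => // n IHn c; exists (fun=> 0) => // s _; exact: wderiv_cst. Qed.

Lemma wsmoothD n A f g : wsmooth n A f -> wsmooth n A g ->
  wsmooth n A (fun u => f u + g u).
Proof.
elim: n f g => // n IHn f g [f' ff' sf'] [g' gg' sg'].
exists (fun u => f' u + g' u) => [s As|]; last exact: IHn.
by apply: wderivD; [exact: ff'|exact: gg'].
Qed.

Lemma wsmoothM n A f g : wsmooth n A f -> wsmooth n A g ->
  wsmooth n A (fun u => f u * g u).
Proof.
elim: n f g => // n IHn f g sf sg.
have [[f' ff' sf'] [g' gg' sg']] := (sf, sg).
exists (fun u => f' u * g u + f u * g' u) => [s As|].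
  by apply: wderivM; [exact: ff'|exact: gg'].
by apply: wsmoothD; apply: IHn => //; exact: wsmoothW.
Qed.

Lemma wsmooth_comp n A B f g : (forall u, A u -> B (g u)) ->
  wsmooth n A g -> wsmooth n B f -> wsmooth n A (f \o g).
Proof.
move=> AB; elim: n f => // n IHn f sg [f' ff' sf'].
have [g' gg' sg'] := sg.
exists (fun u => (f' \o g) u * g' u) => [s As|].
  by apply: (wderiv_comp AB); [exact: gg'|apply: ff'; exact: AB].
by apply: wsmoothM => //; apply: IHn => //; exact: wsmoothW.
Qed.

(** The derivative [1 + tan ^ 2] is a polynomial in [tan] itself, so the induction closes. *)
Lemma wsmooth_tan n A : (forall u, A u -> cos u != 0) -> wsmooth n A (@tan R).
Proof.
move=> cos0; elim: n => // n IHn; exists (fun u => 1 + tan u * tan u) => [s As|].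
  have := is_derive_tan (cos0 s As); rewrite cos2_tan2 ?cos0// expr2.
  exact: is_derive_wderiv.
by apply: wsmoothD; [exact: wsmooth_cst|exact: wsmoothM].
Qed.

Lemma wsmooth_cos n A : wsmooth n A (@cos R).
Proof.
(* Each function is up to sign the derivative of the other, so the induction carries both. *)
suff [] : wsmooth n A (@cos R) /\ wsmooth n A (@sin R) by [].
elim: n => // n [IHc IHs]; split.
  exists (fun u => -1 * sin u) => [s _|].
    by rewrite mulN1r; apply: is_derive_wderiv; exact: is_derive_cos.
  by apply: wsmoothM => //; exact: wsmooth_cst.
by exists (@cos R) => // s _; apply: is_derive_wderiv; exact: is_derive_sin.
Qed.

End WithinDerivative.

(** * Multiplicative calculus read in logarithmic coordinates *)

Section LogarithmicCoordinates.
Variable R : realType.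
Implicit Types (I J : set (mreal R)) (f g : mreal R -> mreal R) (s a : mreal R).
Implicit Types (u l : R).

Lemma mexpK : cancel (@mexp R) (@mlog R).
Proof. by move=> u; rewrite /mlog /mval /mexp /= expRK. Qed.

Lemma mval_gt0 a : 0 < mval a.
Proof. exact: (gt0 (a : {posnum R})). Qed.

Lemma mlogK : cancel (@mlog R) (@mexp R).
Proof.
move=> a; apply: val_inj; rewrite /= /mlog lnK// posrE; exact: mval_gt0.
Qed.

Definition log_dom I : set R := [set u | I (mexp u)].
Definition log_fun f : R -> R := fun u => mlog (f (mexp u)).

Lemma log_domE I s : log_dom I (mlog s) = I s.
Proof. by rewrite /log_dom/= mlogK. Qed.

Lemma minterval_log I : minterval I <-> nondeg_interval (log_dom I).
Proof.
split=> -[itvI [s1 [s2 [Is1 Is2 s12]]]]; split.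
- move=> u v Iu Iv w /andP[uw wv].
  have [|||c Ic cw] := itvI (expR u) (expR v) _ _ (expR w).
  + by exists (mexp u).
  + by exists (mexp v).
  + by rewrite !ler_expR uw.
  by rewrite /log_dom/= (_ : mexp w = c)//; apply: val_inj.
- exists (mlog s1), (mlog s2); split; rewrite ?log_domE//.
  by move=> /(can_inj mlogK).
- move=> _ _ [a Ia <-] [b Ib <-] z /andP[az zb].
  have z0 : 0 < z := lt_le_trans (mval_gt0 a) az.
  exists (mexp (ln z)); last by rewrite /mexp/mval/= lnK// posrE.
  apply: (itvI (mlog a) (mlog b)); rewrite ?log_domE//.
  by rewrite /mlog !ler_ln ?posrE ?mval_gt0// az.
- exists (mexp s1), (mexp s2); split => //.
  by move=> /(can_inj mexpK).
Qed.

Lemma continuous_mlog : continuous (@mlog R).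
Proof.
move=> a; apply: (@continuous_comp _ _ _ (@mval R) (@ln R)).
  exact: initial_continuous.
by apply: continuous_ln; exact: mval_gt0.
Qed.

Lemma continuous_mexp : continuous (@mexp R).
Proof. by apply: continuous_comp_initial; exact: continuous_expR. Qed.

(** Under [h = mexp (u - mlog s)] one has [s +_* h = mexp u], and the logarithm of the
    multiplicative quotient is exactly the ordinary quotient of [log_fun f]. Continuity of [mlog]
    and [mexp] carries the limits in both directions. *)
Lemma mquotients_cvg I f s a : mquotients I f s --> a <->
  wderiv (log_dom I) (log_fun f) (mlog s) (mlog a).
Proof.
split=> [fa P aP|fa P aP].
  have h0 : mexp (u - mlog s) @[u --> mlog s] --> (mreal0 : mreal R).
    rewrite /mreal0 -[0](subrr (mlog s)).
    apply: (@continuous_comp _ _ _ (fun u => u - mlog s) (@mexp R)).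
      by apply: cvgB; [exact: cvg_id|exact: cvg_cst].
    exact: continuous_mexp.
  suff : nbhs (mlog s) [set u | u != mlog s -> I (mexp u) ->
      P ((log_fun f u - log_fun f (mlog s)) / (u - mlog s))] by [].
  pose q h := mlog ((f (s +_* h) -_* f s) /_* h).
  have fP : nbhs (mlog s) [set u | mexp (u - mlog s) <> mreal0 /\
      I (s +_* mexp (u - mlog s)) -> P (q (mexp (u - mlog s)))].
    exact: h0 _ (fa _ (continuous_mlog aP)).
  apply: filterS fP => u /= uP us Iu.
  have su : s +_* mexp (u - mlog s) = mexp u by rewrite /madd mexpK subrKC.
  move: uP; rewrite /q su /mdiv /msub !mexpK /log_fun mlogK; apply; split => //.
  by move=> /(can_inj mexpK) /eqP; rewrite subr_eq0 (negbTE us).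
have h0 : mlog s + mlog h @[h --> (mreal0 : mreal R)] -->
    mlog s + mlog (mreal0 : mreal R).
  apply: (@continuous_comp _ _ _ (@mlog R) (fun v => mlog s + v)).
    exact: continuous_mlog.
  by apply: cvgD; [exact: cvg_cst|exact: cvg_id].
rewrite mexpK addr0 in h0.
have aP' : nbhs (mlog a) [set u | P (mexp u)].
  by apply: continuous_mexp; rewrite mlogK.
suff : nbhs (mreal0 : mreal R) [set h | h <> mreal0 /\ I (s +_* h) ->
    P ((f (s +_* h) -_* f s) /_* h)] by [].
pose q u := (log_fun f u - log_fun f (mlog s)) / (u - mlog s).
have fP : nbhs (mreal0 : mreal R) [set h | mlog s + mlog h != mlog s ->
    I (mexp (mlog s + mlog h)) -> P (mexp (q (mlog s + mlog h)))].
  exact: h0 _ (fa _ aP').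
apply: filterS fP => h /= hP [h1 Ih].
have sh : s +_* h = mexp (mlog s + mlog h) by [].
move: hP; rewrite /q /log_fun -sh mlogK addrAC subrr add0r /mdiv mexpK; apply => //.
rewrite -subr_eq0 addrAC subrr add0r; apply/eqP => h0'.
by apply: h1; rewrite -[h]mlogK h0'.
Qed.

(** Convergence of the quotients means convergence to their own [lim], so that [lim] is identified
    by uniqueness of limits on the real side. *)
Lemma wderiv_mderive I f s l : minterval I -> I s ->
  wderiv (log_dom I) (log_fun f) (mlog s) l ->
  mderivable I f s /\ mderive I f s = mexp l.
Proof.
move=> /minterval_log II Is fl.
have ds : mderivable I f s.
  by apply/cvg_ex; exists (mexp l); apply/mquotients_cvg; rewrite mexpK.
split=> //; rewrite -[LHS]mlogK; congr mexp.
apply: wderiv_unique fl => //; first by rewrite log_domE.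
by apply/mquotients_cvg.
Qed.

Lemma mderivable_wderiv I f u : log_dom I u -> mderivable I f (mexp u) ->
  wderiv (log_dom I) (log_fun f) u (log_fun (mderive I f) u).
Proof.
by move=> Iu /mquotients_cvg; rewrite mexpK.
Qed.

Lemma msmoothP I f : minterval I ->
  msmooth I f <-> forall n, wsmooth n (log_dom I) (log_fun f).
Proof.
move=> II; split=> [+ n|].
  elim: n f => // n IHn f sf; exists (log_fun (mderive I f)) => [u Iu|].
    by apply: mderivable_wderiv => //; exact: (sf 0%N).
  by apply: IHn => k s Is; rewrite -iterSr; exact: sf.
(* Derivability of the [n]-th iterated derivative takes [n.+1] levels of [wsmooth]. *)
move=> sf n; move: (sf n.+1); elim: n f {sf} => [|n IHn] f [f' ff' sf'] s Is.
  have [|] // := wderiv_mderive (f := f) (l := f' (mlog s)) II Is.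
  by apply: ff'; rewrite log_domE.
rewrite iterSr; apply: IHn => //; apply: (@wsmooth_eq _ n.+1 _ f') sf' => u Iu.
have [|_ du] := wderiv_mderive (f := f) (l := f' u) II Iu.
  by rewrite mexpK; exact: ff'.
by rewrite /log_fun du mexpK.
Qed.

Lemma msmooth_wderiv I f u : minterval I -> msmooth I f -> log_dom I u ->
  wderiv (log_dom I) (log_fun f) u (log_fun (mderive I f) u).
Proof. by move=> II sf Iu; apply: mderivable_wderiv => //; exact: (sf 0%N). Qed.

Lemma msmooth_mderive I f : msmooth I f -> msmooth I (mderive I f).
Proof. by move=> sf n s Is; rewrite -iterSr; exact: sf. Qed.

End LogarithmicCoordinates.

(** * The Euclidean inner product and its product rule *)

Section DotProduct.
Variable R : realType.
Implicit Types (v w : 'I_3 -> R) (A : set R) (X Y : R -> 'I_3 -> R).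

Definition dot v w : R := \sum_i v i * w i.

Lemma dotE v w : dot v w = v 0 * w 0 + v 1 * w 1 + v 2%:R * w 2%:R.
Proof.
rewrite /dot !big_ord_recr big_ord0/= add0r.
by congr (v _ * w _ + v _ * w _ + v _ * w _); exact: val_inj.
Qed.

Lemma dotC v w : dot v w = dot w v.
Proof. by apply: eq_bigr => i _; rewrite mulrC. Qed.

Lemma dotZZ p q v w : dot (fun i => p * v i) (fun i => q * w i) = p * q * dot v w.
Proof. by rewrite !dotE; ring. Qed.

Lemma dot_lincomb p q v w :
  dot (fun i => p * v i + q * w i) (fun i => p * v i + q * w i) =
  p ^+ 2 * dot v v + 2 * p * q * dot v w + q ^+ 2 * dot w w.
Proof. by rewrite !dotE; ring. Qed.

Lemma dot_ge0 v : 0 <= dot v v.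
Proof. by apply: sumr_ge0 => i _; rewrite -expr2 sqr_ge0. Qed.

Lemma dot_eq0 v : dot v v = 0 -> forall i, v i = 0.
Proof.
move=> /eqP; rewrite psumr_eq0 => [/allP vv i|i _]; last by rewrite -expr2 sqr_ge0.
by have := vv i (mem_index_enum i); rewrite /= mulf_eq0 orbb => /eqP.
Qed.

Lemma wderiv_dot A X Y (X' Y' : 'I_3 -> R) u :
  (forall i, wderiv A (X^~ i) u (X' i)) -> (forall i, wderiv A (Y^~ i) u (Y' i)) ->
  wderiv A (fun u => dot (X u) (Y u)) u (dot X' (Y u) + dot (X u) Y').
Proof.
move=> XX' YY'; rewrite /dot -big_split/=; apply: wderiv_sum => i.
exact: wderivM.
Qed.

(** Twice this inner product is the derivative of a constant. It is applied to the spherical curve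
    and to the unit tangent. *)
Lemma dot_wderiv_eq0 A X (X' : 'I_3 -> R) d u : nondeg_interval A -> A u ->
  (forall i, wderiv A (X^~ i) u (X' i)) ->
  (forall t, A t -> dot (X t) (X t) = d) -> dot (X u) X' = 0.
Proof.
move=> nA Au XX' Xd; have XX := wderiv_eq Xd Au (wderiv_dot XX' XX').
have := wderiv_unique nA Au XX (wderiv_cst A d u).
by rewrite [dot X' _]dotC -mulr2n => /eqP; rewrite mulrn_eq0/= => /eqP.
Qed.

End DotProduct.

(** * Unit speed curves: the condition [X . X'' = 0] and the squared norm *)

Section RectifyingCurve.
Variable R : realType.
Variables (A : set R) (X X' X'' : R -> 'I_3 -> R).
Hypothesis A_itv : nondeg_interval A.
Hypothesis XX' : forall u, A u -> forall i, wderiv A (X^~ i) u (X' u i).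
Hypothesis X'X'' : forall u, A u -> forall i, wderiv A (X'^~ i) u (X'' u i).
Hypothesis X'1 : forall u, A u -> dot (X' u) (X' u) = 1.

Let g u := dot (X u) (X' u).

Lemma wderiv_tangential u : A u -> wderiv A g u (1 + dot (X u) (X'' u)).
Proof.
move=> Au; rewrite -(X'1 Au); apply: wderiv_dot => i; [exact: XX'|exact: X'X''].
Qed.

Lemma wderiv_sqnorm u : A u -> wderiv A (fun u => dot (X u) (X u)) u (2 * g u).
Proof.
move=> Au; have := wderiv_dot (XX' Au) (XX' Au).
by rewrite [dot (X' u) _]dotC -/(g u) -mulr2n mulr_natl.
Qed.

Lemma rectifying_sqnorm :
  (forall u, A u -> dot (X'' u) (X'' u) != 0) ->
  (forall u, A u -> dot (X u) (X'' u) = 0) ->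
  exists c, exists2 a, 0 < a &
    forall u, A u -> g u = u + c /\ dot (X u) (X u) = (u + c) ^+ 2 + a ^+ 2.
Proof.
move=> X''0 XX''0; have [itvA [s1 [s2 [As1 As2 s12]]]] := A_itv.
have g1 u : A u -> wderiv A g u 1.
  by move=> Au; have := wderiv_tangential Au; rewrite XX''0// addr0.
pose c := g s1 - s1; pose d := dot (X s1) (X s1) - g s1 * g s1.
have gE u : A u -> g u = u + c.
  move=> Au; suff : g u - u = g s1 - s1 by rewrite /c; lra.
  apply: (wderiv0_cst (f := fun u => g u - u) itvA _ Au As1) => s As.
  by have := wderivB (g1 s As) (wderiv_id A s); rewrite subrr.
have dE u : A u -> dot (X u) (X u) - g u * g u = d.
  move=> Au.
  apply: (wderiv0_cst (f := fun u => dot (X u) (X u) - g u * g u) itvA _ Au As1).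
  move=> s As; have := wderivB (wderiv_sqnorm As) (wderivM (g1 s As) (g1 s As)).
  by rewrite mul1r mulr1 -mulr2n mulr_natl subrr.
have dV u : A u ->
    d = dot (fun i => 1 * X u i + - g u * X' u i)
            (fun i => 1 * X u i + - g u * X' u i).
  by move=> Au; rewrite dot_lincomb -/(g u) X'1// -(dE u Au); ring.
have d0 : 0 < d.
  rewrite lt_def {2}(dV s1 As1) dot_ge0 andbT; apply/eqP => d0.
  have XE u i : A u -> g u * X' u i = X u i.
    move=> Au; have /dot_eq0/(_ i) := etrans (esym (dV u Au)) d0.
    by rewrite mul1r mulNr => /eqP; rewrite subr_eq0 => /eqP.
  (* Differentiating [X = g X'] gives [X' = X' + g X''], so [g X'' = 0] while [X''] is nonzero. Then
     [g = u + c] would vanish at both [s1] and [s2]. *)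
  have g0 u : A u -> g u = 0.
    move=> Au; apply/eqP/negPn/negP => gu0; have /eqP := X''0 u Au; apply.
    rewrite /dot big1// => i _; suff -> : X'' u i = 0 by rewrite mulr0.
    apply: (mulfI gu0); rewrite mulr0.
    have XgX' := wderivM (g1 u Au) (X'X'' Au (i := i)).
    have XgX := wderiv_eq (fun v Av => XE v i Av) Au XgX'.
    have := wderiv_unique A_itv Au XgX (XX' Au (i := i)).
    by rewrite mul1r; lra.
  by apply: s12; have := gE s1 As1; have := gE s2 As2; rewrite !g0//; lra.
exists c, (Num.sqrt d); rewrite ?sqrtr_gt0// => u Au; rewrite gE//; split=> //.
by rewrite sqr_sqrtr ?ltW// -(dE u Au) gE//; ring.
Qed.

(** Two distinct zeros of [tan] in [B] are zeros of [sin], and the mean value theorem would put a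
    zero of [cos] in [B]. *)
Lemma tan_eq0_unique (B : set R) s t : is_interval B ->
  (forall u, B u -> cos u != 0) -> B s -> B t -> tan s = 0 -> tan t = 0 -> s = t.
Proof.
move=> itvB cos0; have tan0 u : B u -> tan u = 0 -> sin u = 0.
  by move=> Bu /eqP; rewrite mulf_eq0 invr_eq0 (negbTE (cos0 u Bu)) orbF => /eqP.
wlog st : s t / s < t => [hw|] Bs Bt s0 t0.
  have [st|ts|//] := ltgtP s t; first exact: hw.
  by apply/esym/hw.
have sinB u : B u -> wderiv B (@sin R) u (cos u).
  by move=> _; apply: is_derive_wderiv; exact: is_derive_sin.
have [c Bc] := wderiv_MVT itvB sinB Bs Bt st.
rewrite !tan0// subrr => /esym/eqP.
by rewrite mulf_eq0 (negbTE (cos0 c Bc)) subr_eq0 => /eqP.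
Qed.

(** [theta] enters through its values and its injectivity only, so that a mere choice of preimages
    can serve as [theta]. Differentiability of [X''] provides the continuity of [X . X'']. *)
Lemma normal_of_sqnorm (B : set R) (theta : R -> R) a : is_interval B ->
  (forall t, B t -> cos t != 0) -> (forall u, A u -> B (theta u)) ->
  (forall u v, A u -> A v -> theta u = theta v -> u = v) -> a != 0 ->
  (forall u, A u -> forall i, exists l, wderiv A (X''^~ i) u l) ->
  (forall u, A u -> dot (X u) (X u) = a ^+ 2 + g u ^+ 2) ->
  (forall u, A u -> g u ^+ 2 = a ^+ 2 * tan (theta u) ^+ 2) ->
  forall u, A u -> dot (X u) (X'' u) = 0.
Proof.
move=> itvB cos0 AB inj a0 X''d nX gX u Au.
(* Differentiating [|X|^2 = a^2 + g^2] gives [2 g = 2 g (1 + X . X'')], that is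
   [g (X . X'') = 0]. *)
have gg u0 : A u0 -> dot (X u0) (X'' u0) != 0 -> g u0 = 0.
  move=> Au0 XX0.
  have gd := wderivD (wderiv_cst A (a ^+ 2) u0)
    (wderivM (wderiv_tangential Au0) (wderiv_tangential Au0)).
  have eqX v : A v -> a ^+ 2 + g v * g v = dot (X v) (X v).
    by move=> Av; rewrite nX// expr2.
  have h := wderiv_unique A_itv Au0 (wderiv_eq eqX Au0 gd) (wderiv_sqnorm Au0).
  apply/eqP; have : g u0 * dot (X u0) (X'' u0) == 0 by apply/eqP; lra.
  by rewrite mulf_eq0 (negbTE XX0) orbF.
have g0 u0 : A u0 -> g u0 = 0 -> tan (theta u0) = 0.
  move=> Au0 gu0; have /esym/eqP := gX u0 Au0.
  by rewrite gu0 expr0n mulf_eq0 !sqrf_eq0 (negbTE a0) => /eqP.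
apply/eqP/negPn/negP => XX0.
have FF := nondeg_interval_proper A_itv Au.
have /choice[l Xl] i := X''d u Au i.
(* By continuity [X . X''] is also nonzero at some [v] of [A] other than [u]. Then [g], and with it
   [tan (theta _)], vanishes at both points, so [theta u = theta v], against injectivity. *)
have XXc := wderiv_cvg (wderiv_dot (XX' Au) Xl).
have XXn : \forall v \near within A u^', dot (X v) (X'' v) != 0.
  by apply: cvgr_neq0 XX0; exact: XXc.
have An : \forall v \near within A u^', A v /\ v != u.
  exact: near_within_dnbhs.
have [v [[Av vu] XXv]] := filter_ex (filterI An XXn).
move/eqP: vu; apply; apply: inj => //.
by apply: (tan_eq0_unique itvB cos0) (AB _ _) (AB _ _) (g0 _ _ _) (g0 _ _ _);
  rewrite ?gg.
Qed.

End RectifyingCurve.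

(** * Vectors and curves of the multiplicative space in logarithmic coordinates *)

Section LogarithmicVectors.
Variable R : realType.
Implicit Types (p q : mspace R) (x y : mreal R -> mspace R) (I : set (mreal R)).

Definition log_vec p : 'I_3 -> R := fun i => mlog (mcoord p i).
Definition log_curve x : R -> 'I_3 -> R := fun u => log_vec (x (mexp u)).

Lemma mexp_eq0 (u : R) : mexp u = mreal0 <-> u = 0.
Proof. by split=> [/(can_inj (@mexpK R))|->]. Qed.

Lemma mnorm_eq1 p : mnorm p = mreal1 <-> dot (log_vec p) (log_vec p) = 1.
Proof.
rewrite /mnorm /msqrt /minner mexpK -/(dot (log_vec p) (log_vec p)).
split=> [/(can_inj (@mexpK R)) p1|->]; last by rewrite sqrtr1.
by rewrite -[LHS]sqr_sqrtr ?dot_ge0// p1 expr1n.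
Qed.

Lemma mnorm_eq0 p : mnorm p = mreal0 <-> dot (log_vec p) (log_vec p) = 0.
Proof.
rewrite /mnorm /msqrt /minner mexpK -/(dot (log_vec p) (log_vec p)) mexp_eq0.
split=> [p0|->]; last exact: sqrtr0.
by rewrite -[LHS]sqr_sqrtr ?dot_ge0// p0 expr0n.
Qed.

Lemma minner_eq0 p q : minner p q = mreal0 <-> dot (log_vec p) (log_vec q) = 0.
Proof. exact: mexp_eq0. Qed.

(** Lagrange's identity: the two sides differ by the squared norm of the cross product. It will
    yield biregularity in the converse. *)
Lemma mcollinear_lagrange p q : mcollinear p q ->
  dot (log_vec p) (log_vec p) * dot (log_vec q) (log_vec q) =
  dot (log_vec p) (log_vec q) ^+ 2.
Proof.
move=> /rowP pq.
have cross i : log_vec p (i + 1) * log_vec q (i + 2%:R) =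
               log_vec p (i + 2%:R) * log_vec q (i + 1).
  by have := pq i; rewrite !mxE => /mexp_eq0 /eqP; rewrite subr_eq0 => /eqP.
have := cross 0; have := cross 1; have := cross 2%:R; rewrite !dotE.
have -> : 0 + 1 = 1 :> 'I_3 by exact: val_inj.
have -> : 0 + 2%:R = 2%:R :> 'I_3 by exact: val_inj.
have -> : 1 + 1 = 2%:R :> 'I_3 by exact: val_inj.
have -> : 1 + 2%:R = 0 :> 'I_3 by exact: val_inj.
have -> : 2%:R + 1 = 0 :> 'I_3 by exact: val_inj.
have -> : 2%:R + 2%:R = 1 :> 'I_3 by exact: val_inj.
move: (log_vec p 0) (log_vec p 1) (log_vec p 2%:R).
move: (log_vec q 0) (log_vec q 1) (log_vec q 2%:R) => a b c a' b' c'.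
move=> h2 h1 h0; apply/eqP; rewrite -subr_eq0; apply/eqP.
transitivity ((a' * b - b' * a) ^+ 2 + (b' * c - c' * b) ^+ 2
            + (c' * a - a' * c) ^+ 2).
  by ring.
by rewrite h0 h1 h2 !subrr expr0n !addr0.
Qed.

Lemma mvderive_curve I x : mcurve I x -> mcurve I (mvderive I x).
Proof.
move=> [II sx]; split; [exact: II|move=> i].
rewrite (_ : (fun v => _) = mderive I (fun v => mcoord (x v) i)).
  exact: msmooth_mderive.
by apply/funext => v; rewrite /mcoord /mvderive mxE.
Qed.

Lemma mcurve_wderiv I x u : mcurve I x -> log_dom I u ->
  forall i, wderiv (log_dom I) (fun u => log_curve x u i) u
    (log_curve (mvderive I x) u i).
Proof.
move=> [II sx] Iu i; have := msmooth_wderiv II (sx i) Iu.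
rewrite (_ : log_fun (mderive _ _) u = log_curve (mvderive I x) u i)//.
by rewrite /log_curve /log_vec {2}/mcoord /mvderive mxE.
Qed.

Lemma mcurve_of_log I x (X : R -> 'I_3 -> R) : minterval I ->
  (forall u i, log_dom I u -> log_curve x u i = X u i) ->
  (forall n i, wsmooth n (log_dom I) (X^~ i)) -> mcurve I x.
Proof.
move=> II xX sX; split; [exact: II|move=> i]; apply/msmoothP => // n.
by apply: (wsmooth_eq _ (sX n i)) => u Iu; rewrite -xX.
Qed.

(** Reads off the derivative of a curve from any formula for its logarithm valid on the domain. *)
Lemma log_curve_mvderive I x X X' u : mcurve I x -> log_dom I u ->
  (forall v i, log_dom I v -> log_curve x v i = X v i) ->
  (forall i, wderiv (log_dom I) (X^~ i) u (X' i)) ->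
  log_curve (mvderive I x) u = X'.
Proof.
move=> cx Iu xX XX'; apply/funext => i.
have II : nondeg_interval (log_dom I) by apply/minterval_log; exact: cx.1.
apply: (wderiv_unique II Iu _ (XX' i)).
by apply: wderiv_eq (mcurve_wderiv cx Iu (i := i)) => // v Iv; exact: xX.
Qed.

End LogarithmicVectors.

(** * From rectifying curves to the secant form *)

Section SecantForm.
Variable R : realType.
Implicit Types (x y : mreal R -> mspace R) (I J : set (mreal R)).

Lemma minner_mvdiv_eq0 (p q : mspace R) a : mlog a != 0 ->
  minner p (mvdiv q a) = mreal0 <-> dot (log_vec p) (log_vec q) = 0.
Proof.
move=> a0; rewrite minner_eq0.
have -> : dot (log_vec p) (log_vec (mvdiv q a)) =
    dot (log_vec p) (log_vec q) / mlog a.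
  rewrite /dot mulr_suml; apply: eq_bigr => i _.
  by rewrite -mulrA; congr (_ * _); rewrite /log_vec {1}/mcoord mxE mexpK.
split=> [/eqP|->]; last by rewrite mul0r.
by rewrite mulf_eq0 invr_eq0 (negbTE a0) orbF => /eqP.
Qed.

Lemma mcurvature_log_neq0 I x u : mcurvature_neq0 I x -> log_dom I u ->
  dot (log_curve (mvderive I (mvderive I x)) u)
      (log_curve (mvderive I (mvderive I x)) u) != 0.
Proof. by move=> k0 Iu; apply/eqP => /mnorm_eq0; exact: k0. Qed.

(** The normal is the second derivative divided by the curvature, whose logarithm is nonzero, so the
    rectifying condition reads [X . X'' = 0]. *)
Lemma mnormal_eq0 I x u : mcurvature_neq0 I x -> log_dom I u ->
  minner (x (mexp u)) (mnormal I x (mexp u)) = mreal0 <->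
  dot (log_curve x u) (log_curve (mvderive I (mvderive I x)) u) = 0.
Proof.
move=> k0 Iu; apply: minner_mvdiv_eq0; apply/eqP => k1.
by apply: (k0 _ Iu); rewrite -[LHS]mlogK k1.
Qed.

Lemma marc_length_dot I x u : marc_length I x -> log_dom I u ->
  dot (log_curve (mvderive I x) u) (log_curve (mvderive I x) u) = 1.
Proof. by move=> [_ x1] Iu; apply/mnorm_eq1; exact: x1. Qed.

(** * The substitution [u + c = a tan t] and the projection to the sphere *)

Section ForwardConstruction.
Variables (I : set (mreal R)) (x : mreal R -> mspace R) (a c : R).
Hypothesis cx : mcurve I x.
Hypothesis a0 : 0 < a.
Let A := log_dom I.
Let X := log_curve x.
Let X' := log_curve (mvderive I x).
Hypothesis X'1 : forall u, A u -> dot (X' u) (X' u) = 1.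
Hypothesis XX' : forall u, A u -> dot (X u) (X' u) = u + c.
Hypothesis nX : forall u, A u -> dot (X u) (X u) = (u + c) ^+ 2 + a ^+ 2.

Let F (t : R) : R := a * tan t - c.

Definition secant_param (t : mreal R) : mreal R := mexp (a * tan (mlog t) - c).
(** On the principal branch [tan] is injective and [cos] is positive. *)
Definition secant_dom : set (mreal R) :=
  [set t | - (pi / 2) < mlog t < pi / 2 /\ I (secant_param t)].
(** The radial projection [X / |X|], because [|X| = a sec t] at the parameter [a tan t - c]. *)
Definition secant_proj (t : mreal R) : mspace R :=
  \row_i mexp (a^-1 * cos (mlog t) * X (a * tan (mlog t) - c) i).

Let B := log_dom secant_dom.

Lemma log_secant_dom u : B u = (- (pi / 2) < u < pi / 2 /\ A (F u)).
Proof. by rewrite /B /log_dom/= /secant_dom/= /secant_param mexpK. Qed.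

Lemma cos_secant_dom u : B u -> cos u != 0.
Proof.
rewrite log_secant_dom => -[u0 _]; rewrite gt_eqF// cos_gt0_pihalf//.
Qed.

(** Solving [v + c = a tan t] inverts the change of parameter. This gives its surjectivity, and two
    distinct points in the new domain. *)
Lemma atan_secant_dom v : A v -> B (atan ((v + c) / a)) /\ F (atan ((v + c) / a)) = v.
Proof.
move=> Av; have Fv : F (atan ((v + c) / a)) = v.
  by rewrite /F atanK mulrC divfK ?gt_eqF// addrK.
rewrite log_secant_dom Fv; split=> //; split=> //.
by rewrite atan_gtNpi2 atan_ltpi2.
Qed.

Lemma minterval_secant_dom : minterval secant_dom.
Proof.
have [itvA [s1 [s2 [As1 As2 s12]]]] : nondeg_interval A.
  by apply/minterval_log; exact: cx.1.
apply/minterval_log; split.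
  move=> s t; rewrite -/B !log_secant_dom => -[Is As] [It At] u /andP[su ut].
  have Iu : - (pi / 2) < u < pi / 2.
    move: Is It => /andP[s0 _] /andP[_ t0].
    by rewrite (lt_le_trans s0 su) (le_lt_trans ut t0).
  rewrite -/B log_secant_dom; split=> //; apply: (itvA _ _ As At).
  have le_tan : {in `](- (pi / 2)), (pi / 2)[ &, {mono (@tan R) : x y / x <= y}}.
    by apply: le_mono_in => v w Iv Iw; rewrite ltr_tan.
  by rewrite !lerD2r !ler_pM2l// !le_tan ?in_itv//= su.
exists (atan ((s1 + c) / a)), (atan ((s2 + c) / a)).
have [Bs1 Fs1] := atan_secant_dom As1; have [Bs2 Fs2] := atan_secant_dom As2.
by split=> // s12'; apply: s12; rewrite -Fs1 s12'.
Qed.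

Lemma wderiv_secant_param u : B u -> wderiv B F u (a * (cos u) ^- 2).
Proof.
move=> Bu; rewrite -[a * _]subr0.
apply: wderivB; last exact: wderiv_cst.
by apply/wderivZ/is_derive_wderiv/is_derive_tan/cos_secant_dom.
Qed.

Lemma wsmooth_secant_param n : wsmooth n B F.
Proof.
apply: wsmoothD; last exact: wsmooth_cst.
by apply: wsmoothM; [exact: wsmooth_cst|apply: wsmooth_tan; exact: cos_secant_dom].
Qed.

Lemma log_secant_param u : log_fun secant_param u = F u.
Proof. by rewrite /log_fun /secant_param !mexpK. Qed.

Lemma mreparametrization_secant : mreparametrization secant_dom I secant_param.
Proof.
have mJ := minterval_secant_dom; split.
- exact: mJ.
- exact: cx.1.
- split.
  + by move=> t [].
  + move=> s t /set_mem[Is _] /set_mem[It _].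
    move=> /(can_inj (@mexpK R)) /(addIr _).
    move=> /(mulfI (lt0r_neq0 a0)) /tan_inj st.
    have {}st : mlog s = mlog t by apply: st; rewrite in_itv.
    by rewrite -[s]mlogK -[t]mlogK st.
  + move=> s Is; have [|Bs Fs] := @atan_secant_dom (mlog s).
      by rewrite /A log_domE.
    exists (mexp (atan ((mlog s + c) / a))); first exact: Bs.
    by rewrite /secant_param mexpK -/(F _) Fs mlogK.
- apply/msmoothP => // n; apply: wsmooth_eq (wsmooth_secant_param n) => u _.
  by rewrite log_secant_param.
- move=> t Jt; have Bt : B (mlog t) by rewrite /B log_domE.
  have [|_ ->] := wderiv_mderive (f := secant_param)
    (l := a * (cos (mlog t)) ^- 2) mJ Jt.
    apply: wderiv_eq (wderiv_secant_param Bt) => // u _.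
    by rewrite log_secant_param.
  move=> /mexp_eq0 /eqP; rewrite mulf_eq0 invr_eq0 sqrf_eq0.
  by rewrite (negbTE (cos_secant_dom Bt)) gt_eqF.
Qed.

Let Y (u : R) (i : 'I_3) : R := a^-1 * cos u * X (F u) i.

Lemma log_secant_proj u i : log_curve secant_proj u i = Y u i.
Proof. by rewrite /log_curve /log_vec /mcoord mxE !mexpK. Qed.

Lemma secant_proj_sphere t : secant_dom t -> msphere mreal1 (secant_proj t).
Proof.
move=> Jt; have : B (mlog t) by rewrite /B log_domE.
rewrite -[t]mlogK; move: (mlog t) => u; rewrite mexpK => Bu; apply/mnorm_eq1.
rewrite -/(log_curve secant_proj u) (funext (log_secant_proj u)) /Y dotZZ nX.
  have c0 := cos_secant_dom Bu; have := cos2Dsin2 u.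
  rewrite /F /tan subrK => cs; have a0' := lt0r_neq0 a0.
  by transitivity (cos u ^+ 2 + sin u ^+ 2); [field; rewrite c0|].
by move: Bu; rewrite log_secant_dom => -[].
Qed.

Lemma secant_proj_arc_length : marc_length secant_dom secant_proj.
Proof.
have mJ := minterval_secant_dom.
have AF u : B u -> A (F u) by rewrite log_secant_dom => -[].
have cy : mcurve secant_dom secant_proj.
  apply: (mcurve_of_log (X := Y)); first exact: mJ.
    by move=> u i _; exact: log_secant_proj.
  move=> n i; apply: wsmoothM.
    by apply: wsmoothM; [exact: wsmooth_cst|exact: wsmooth_cos].
  apply: (wsmooth_comp (f := X^~ i) AF); first exact: wsmooth_secant_param.
  exact: (proj1 (msmoothP _ cx.1) (cx.2 i) n).
split; first exact: cy.
move=> t Jt; have : B (mlog t) by rewrite /B log_domE.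
rewrite -[t]mlogK; move: (mlog t) => u; rewrite mexpK => Bu; apply/mnorm_eq1.
have c0 := cos_secant_dom Bu; have a0' := lt0r_neq0 a0.
rewrite -/(log_curve (mvderive secant_dom secant_proj) u).
(* Product and chain rule: the factor [a^-1 cos u] times the speed [a / cos^2 u] of [F] leaves
   [1 / cos u] in front of [X']. *)
rewrite (log_curve_mvderive (X := Y) (X' := fun i =>
    a^-1 * - sin u * X (F u) i + (cos u)^-1 * X' (F u) i) cy Bu).
- rewrite dot_lincomb nX ?XX' ?X'1; try exact: AF.
  rewrite /F /tan subrK; have := cos2Dsin2 u.
  move: (cos u) (sin u) c0 => k s k0 ks.
  have {}ks : s ^+ 2 = 1 - k ^+ 2 by rewrite -ks addrAC subrr add0r.
  (* With [|X|^2 = a^2 tan^2 + a^2], [X . X' = a tan] and [|X'| = 1] inserted, [a] cancels, and the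
     numerator is [1 - s^2 = k^2]. *)
  transitivity ((s ^+ 2 * (k ^+ 2 + s ^+ 2) - 2 * s ^+ 2 + 1) / k ^+ 2).
    by field; rewrite ?a0' ?c0 ?k0.
  by rewrite ks; field.
- by move=> v i _; exact: log_secant_proj.
- move=> i.
  have XF := wderiv_comp AF (wderiv_secant_param Bu)
    (mcurve_wderiv cx (AF _ Bu) (i := i)).
  have cosD : wderiv B (@cos R) u (- sin u).
    by apply: is_derive_wderiv; exact: is_derive_cos.
  have := wderivM (wderivZ (c := a^-1) cosD) XF.
  rewrite -/X -/X' /=; congr wderiv.
  by rewrite /X'; field; rewrite ?a0' ?c0 ?k0.
Qed.

Lemma secant_formE t : secant_dom t ->
  x (secant_param t) = mvscale (mexp a *_* msec t) (secant_proj t).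
Proof.
move=> Jt; have Bt : B (mlog t) by rewrite /B log_domE.
have c0 := cos_secant_dom Bt; have a0' := lt0r_neq0 a0.
apply/rowP => i; rewrite !mxE /mmul !mexpK.
rewrite /mcoord mxE mexpK /X /log_curve /log_vec -/(secant_param t).
rewrite -[LHS]mlogK; congr mexp.
by rewrite /mcoord; field; rewrite ?a0' ?c0 ?k0.
Qed.

Lemma msecant_formP : msecant_form I x.
Proof.
exists secant_dom, secant_param, (mexp a), secant_proj; split.
- split; first exact: mreparametrization_secant.
  by rewrite /mlt /mval/= ltr_expR.
- move=> t Jt; apply/eqP; apply: cos_secant_dom.
  by rewrite /B log_domE.
- exact: secant_proj_arc_length.
- exact: secant_proj_sphere.
- exact: secant_formE.
Qed.

End ForwardConstruction.

Lemma rectifying_secant_form I x : marc_length I x -> mcurvature_neq0 I x ->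
  mrectifying I x -> msecant_form I x.
Proof.
move=> lx k0 [_ _ xn]; have cx := lx.1; have cx' := mvderive_curve cx.
have XX'' u : log_dom I u ->
    dot (log_curve x u) (log_curve (mvderive I (mvderive I x)) u) = 0.
  by move=> Iu; apply/(mnormal_eq0 k0 Iu); exact: xn.
have II : nondeg_interval (log_dom I) by apply/minterval_log; exact: cx.1.
have [c [a a0 ca]] := rectifying_sqnorm II (fun u => mcurve_wderiv cx (u := u))
  (fun u => mcurve_wderiv cx' (u := u)) (fun u => marc_length_dot lx (u := u))
  (fun u => mcurvature_log_neq0 k0 (u := u)) XX''.
apply: (msecant_formP cx a0 (c := c)).
- by move=> u; exact: marc_length_dot.
- by move=> u /ca[].
- by move=> u /ca[].
Qed.

End SecantForm.

(** * From the secant form back to rectifying curves *)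

Section Converse.
Variable R : realType.
Implicit Types (x y u : mreal R -> mspace R) (I J K : set (mreal R)).

(* [q] and [p] are the speeds of the secant parametrization and of the arc
   length parametrization, [k] and [s] the cosine and sine of the angle. *)
Lemma secant_pointwise (X X' Y Y' : 'I_3 -> R) (a k s p q : R) :
  a != 0 -> k != 0 -> k ^+ 2 + s ^+ 2 = 1 ->
  dot Y Y = 1 -> dot Y' Y' = 1 -> dot Y Y' = 0 ->
  (forall i, k * X i = a * Y i) ->
  (forall i, - s * X i + k * q * X' i = a * Y' i) ->
  p ^+ 2 * dot X' X' = 1 ->
  dot X X = a ^+ 2 + (p * dot X X') ^+ 2 /\
  (p * dot X X') ^+ 2 = a ^+ 2 * (s / k) ^+ 2.
Proof.
move=> a0 k0 ks YY Y'Y' YY' XY XY' pX'.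
set n := dot X X; set S := dot X X'; set P := dot X' X' in pX' *.
have nE : k ^+ 2 * n = a ^+ 2.
  have := dotZZ a a Y Y; rewrite YY -(funext XY) dotZZ -/n !mulr1.
  by rewrite -!expr2.
(* [Y] and [Y'] are orthogonal, so the vector [k X = a Y] is orthogonal to its derivative
   [- s X + k q X']. *)
have SE : k * q * S = s * n.
  apply: (mulfI k0).
  have : dot (fun i => a * Y i) (fun i => a * Y' i) = 0.
    by rewrite dotZZ YY' mulr0.
  rewrite -(funext XY) -(funext XY') => h.
  have {h} : k * (k * q * S - s * n) = 0.
    by rewrite -h /S /n !dotE; ring.
  by lra.
have PE : k ^+ 2 * q ^+ 2 * P = n.
  have := dotZZ a a Y' Y'; rewrite Y'Y' -(funext XY') dot_lincomb -/n -/S -/P.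
  rewrite mulr1 => h.
  transitivity (a * a + 2 * s * (k * q * S) - s ^+ 2 * n); first by rewrite -h; ring.
  rewrite SE -expr2 -nE; transitivity ((k ^+ 2 + s ^+ 2) * n); first by ring.
  by rewrite ks mul1r.
have n0 : n != 0.
  apply/eqP => n0; move/eqP: nE; rewrite n0 mulr0 eq_sym sqrf_eq0.
  by rewrite (negbTE a0).
(* Multiplying by [n = k^2 q^2 P] eliminates [q]: the left side becomes [(p^2 P) (k q S)^2], with
   [p^2 P = 1] and [k q S = s n]. *)
have pS : (p * S) ^+ 2 = s ^+ 2 * n.
  apply: (mulfI n0).
  transitivity ((p ^+ 2 * P) * (k * q * S) ^+ 2); first by rewrite -{1}PE; ring.
  by rewrite pX' SE; ring.
rewrite pS; split; first by rewrite -nE -mulrDl ks mul1r.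
by rewrite -nE; field.
Qed.

(** The arc length curve and the spherical curve are compared at a common point of [x], both
    derivatives being expressed through the same derivative of [x]. The angle is thus handled
    pointwise, without differentiating it. *)
Lemma secant_form_rectifying I x K u : mregular I x ->
  marc_length_param I x K u -> mcurvature_neq0 K u -> msecant_form I x ->
  mrectifying K u.
Proof.
move=> [cx _] [lu [psi [mK _ psiKI sm_psi _] uE]] k0.
move=> [J [phi [a [y [[[mJ _ phiJI sm_phi _] a1] cosJ ly yS yE]]]]].
have cu := lu.1; have cu' := mvderive_curve cu; have cu'' := mvderive_curve cu'.
have cy := ly.1.
have nK : nondeg_interval (log_dom K) by apply/minterval_log.
have nJ : nondeg_interval (log_dom J) by apply/minterval_log.
set A := log_dom K in nK; set B := log_dom J in nJ.
have a0 : mlog a != 0.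
  rewrite gt_eqF// /mlog ln_gt0//; apply: le_lt_trans a1.
  by rewrite /mval/= expR0.
have cosB t : B t -> cos t != 0 by move=> Bt; have /eqP := cosJ _ Bt; rewrite mexpK.
have psiA k : A k -> log_dom I (log_fun psi k).
  by move=> Ak; rewrite /log_fun log_domE; case: psiKI => + _ _; apply.
have phiB t : B t -> log_dom I (log_fun phi t).
  by move=> Bt; rewrite /log_fun log_domE; case: phiJI => + _ _; apply.
have uX k i : A k -> log_curve u k i = log_curve x (log_fun psi k) i.
  by move=> Ak; rewrite /log_curve uE// /log_fun mlogK.
have yX t i : B t -> cos t * log_curve x (log_fun phi t) i = mlog a * log_curve y t i.
  move=> Bt; rewrite /log_curve /log_fun mlogK yE// /log_vec {1}/mcoord mxE !mexpK.
  by field; exact: cosB.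
(* [theta] plays the role of the inverse of [phi] composed with [psi], chosen by surjectivity of
   [phi]; outside [A] the value 0 is a dummy. Its injectivity comes from that of [psi]. *)
have /choice[theta thetaP] k : exists t, A k -> B t /\ log_fun phi t = log_fun psi k.
  have [Ak|nAk] := pselect (A k); last by exists 0.
  have [_ _ /(_ (psi (mexp k)))[|t Jt pt]] := phiJI.
    by case: psiKI => + _ _; apply.
  by exists (mlog t) => _; rewrite /B log_domE /log_fun mlogK pt.
have theta_inj k l : A k -> A l -> theta k = theta l -> k = l.
  move=> Ak Al kl; have [_ pk] := thetaP k Ak; have [_ pl] := thetaP l Al.
  apply: (can_inj (@mexpK R)); case: psiKI => _ inj _; apply: inj.
  - exact/mem_set.
  - exact/mem_set.
  - by apply: (can_inj (@mlogK R)); rewrite -/(log_fun psi k) -pk kl pl.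
have pw k : A k ->
    dot (log_curve u k) (log_curve u k) =
      mlog a ^+ 2 + dot (log_curve u k) (log_curve (mvderive K u) k) ^+ 2 /\
    dot (log_curve u k) (log_curve (mvderive K u) k) ^+ 2 =
      mlog a ^+ 2 * tan (theta k) ^+ 2.
  move=> Ak; have [Bt pt] := thetaP k Ak; move: (theta k) Bt pt => t Bt pt.
  have uk : log_curve u k = log_curve x (log_fun phi t).
    by apply/funext => i; rewrite pt uX.
  pose p := log_fun (mderive K psi) k; pose q := log_fun (mderive J phi) t.
  have dpsi : wderiv A (log_fun psi) k p by exact: msmooth_wderiv.
  have dphi : wderiv B (log_fun phi) t q by exact: msmooth_wderiv.
  pose X' := log_curve (mvderive I x) (log_fun phi t).
  have xI v i : log_dom I v ->
      wderiv (log_dom I) (fun v => log_curve x v i) v (log_curve (mvderive I x) v i).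
    by move=> Iv; exact: mcurve_wderiv.
  have u'k : log_curve (mvderive K u) k = fun i => p * X' i.
    apply: (log_curve_mvderive cu Ak) => [v i Av|i]; first exact: uX.
    by rewrite /X' pt mulrC; exact: wderiv_comp psiA dpsi (xI _ i (psiA _ Ak)).
  have p1 : p ^+ 2 * dot X' X' = 1.
    by rewrite expr2 -dotZZ -u'k; exact: marc_length_dot lu Ak.
  have YY s : B s -> dot (log_curve y s) (log_curve y s) = 1.
    by move=> Bs; apply/mnorm_eq1; exact: yS.
  have YY' : dot (log_curve y t) (log_curve (mvderive J y) t) = 0.
    exact: (dot_wderiv_eq0 nJ Bt (mcurve_wderiv cy Bt) YY).
  have XY' i : - sin t * log_curve x (log_fun phi t) i + cos t * q * X' i =
      mlog a * log_curve (mvderive J y) t i.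
    have dcos : wderiv B (@cos R) t (- sin t).
      by apply: is_derive_wderiv; exact: is_derive_cos.
    have dX := wderivM dcos (wderiv_comp phiB dphi (xI _ i (phiB _ Bt))).
    have dY := wderivZ (c := mlog a) (mcurve_wderiv cy Bt (i := i)).
    have dX' := wderiv_eq (fun s Bs => yX s i Bs) Bt dX.
    rewrite -(wderiv_unique nJ Bt dX' dY) /=.
    by rewrite -mulrA [q * _]mulrC.
  have [] := secant_pointwise a0 (cosB t Bt) (cos2Dsin2 t) (YY t Bt)
    (marc_length_dot ly Bt) YY' (fun i => yX t i Bt) XY' p1.
  have -> : p * dot (log_curve x (log_fun phi t)) X' =
      dot (log_curve u k) (log_curve (mvderive K u) k).
    by rewrite uk u'k !dotE; ring.
  by rewrite -uk.
have UU'' : forall k, A k ->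
    dot (log_curve u k) (log_curve (mvderive K (mvderive K u)) k) = 0.
  apply: (normal_of_sqnorm nK (fun k => mcurve_wderiv cu (u := k))
    (fun k => mcurve_wderiv cu' (u := k)) (fun k => marc_length_dot lu (u := k))
    nJ.1 cosB (fun k Ak => (thetaP k Ak).1) theta_inj a0).
  - move=> k Ak i; exists (log_curve (mvderive K (mvderive K (mvderive K u))) k i).
    exact: mcurve_wderiv.
  - by move=> k /pw[].
  - by move=> k /pw[].
split; first exact: lu.
  (* Biregularity: unit speed gives [u' . u'' = 0], so under collinearity Lagrange's identity
     reduces to [|u''|^2 = 0], against the nonzero curvature. *)
  move=> s Ks; rewrite -[s]mlogK => coll.
  have {Ks} Ak : A (mlog s) by rewrite /A log_domE.
  have U'U'' := dot_wderiv_eq0 nK Ak (mcurve_wderiv cu' Ak)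
    (fun v => marc_length_dot lu (u := v)).
  have /negP := mcurvature_log_neq0 k0 Ak; apply; apply/eqP.
  rewrite -[LHS]mul1r -(marc_length_dot lu Ak).
  by rewrite (mcollinear_lagrange coll) U'U'' expr0n.
move=> s Ks; rewrite -[s]mlogK; have Ak : A (mlog s) by rewrite /A log_domE.
by apply/(mnormal_eq0 k0 Ak)/UU''.
Qed.

End Converse.

Theorem theorem4p5 (R : realType) :
  (forall (I : set (mreal R)) (x : mreal R -> mspace R),
      marc_length I x -> mcurvature_neq0 I x -> mrectifying I x ->
      msecant_form I x) /\
  (forall (I : set (mreal R)) (x : mreal R -> mspace R),
      mregular I x -> on_arc_length (@mcurvature_neq0 R) I x ->
      msecant_form I x ->
      on_arc_length (@mrectifying R) I x).
Proof.
split=> [I x|I x rx [ex k0] sx]; first exact: rectifying_secant_form.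
(* The curvature hypothesis already supplies an arc length parametrization, which settles the
   existence half of [on_arc_length]. *)
split=> // K u ux; exact: secant_form_rectifying rx ux (k0 _ _ ux) sx.
Qed.
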